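(* For every positive integer $n$, $$8\sum_{m<n/2}\widetilde{\sigma}(m)\widetilde{\sigma}(n-2m)=-2\widetilde{\sigma}_3(n/2)+(n-1)\widetilde{\sigma}(n)+(2n-1)\widetilde{\sigma}(n/2),$$ $$24\sum_{m<n/2}\widetilde{\sigma}(m)\widehat{\sigma}(n-2m)=-2\widetilde{\sigma}_3(n/2)+(2n-3)\widehat{\sigma}(n)+4n\widehat{\sigma}(n/2)+n\widetilde{\sigma}(n)-(2n+1)\widetilde{\sigma}(n/2),$$ $$24\sum_{m<n/2}\widehat{\sigma}(m)\widetilde{\sigma}(n-2m)=\widetilde{\sigma}_3(n)-3\widetilde{\sigma}_3(n/2)+(6n-3)\widehat{\sigma}(n/2)-\widetilde{\sigma}(n),$$ where the sums run over positive integers $m<n/2$.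
   Context: For $s,n\in\mathbb{N}$ (positive integers), $\widetilde{\sigma}_s(n)=\sum_{d\mid n}(-1)^{d-1}d^s$ and $\widehat{\sigma}_s(n)=\sum_{d\mid n}(-1)^{\frac nd-1}d^s$; write $\widetilde{\sigma}=\widetilde{\sigma}_1$, $\widehat{\sigma}=\widehat{\sigma}_1$, and set $\widetilde{\sigma}_s(n)=\widehat{\sigma}_s(n)=0$ if $n$ is not a positive integer. *)

(* Defs.v *)
From mathcomp Require Import all_boot all_order all_algebra.

Set Implicit Arguments.
Unset Strict Implicit.
Unset Printing Implicit Defensive.

Import GRing.Theory Num.Theory.
Local Open Scope ring_scope.

(* Value at [x] of the extension by zero of an arithmetic function [f] to all
   rationals: [f x] if [x] is a positive integer, and 0 otherwise. *)
Definition extend0 (f : nat -> int) (x : rat) : int :=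
  if (x \is a Num.int) && (0 < x) then f `|numq x|%N else 0.

(* The argument is a rational so that values such as that at [n / 2] for odd
   [n] are covered. Since [0 < d] and [0 < n %/ d] for [d \in divisors n] with
   [0 < n], the truncated predecessors are genuine ones. *)
Definition sigma_tilde (s : nat) : rat -> int :=
  extend0 (fun n => \sum_(d <- divisors n) (-1) ^+ d.-1 * d%:Z ^+ s).

Definition sigma_hat (s : nat) : rat -> int :=
  extend0 (fun n => \sum_(d <- divisors n) (-1) ^+ (n %/ d).-1 * d%:Z ^+ s).

(* Main.v *)
Require Import Defs.
From mathcomp Require Import all_boot all_order all_algebra.
From mathcomp Require Import zify ring.

(** Let [H] be the substitution of [q ^ 2] for [q] in generating series, and
    [s] the series of the sum of divisors. Separating the divisors by parity,
    the alternating sums of divisors have the series [s - 4 H s] and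
    [s - 2 H s]. The three sums of the theorem are therefore coefficients of
    products [(H s + a H H s) (s + b H s)], and since [H] is multiplicative they
    are combinations of the coefficients of [s * s], [H s * s] and [H H s * s],
    and of the values of the first two at [n / 2]. It remains to evaluate these
    three convolutions.

    The first two come from an identity of Liouville's type
    ([liouville_identity]). On the positive solutions of [a x + b y = n], the
    map that subtracts [b] from [a] and adds [x] to [y], taken here up to
    exchange of the two products, is a bijection between the solutions with
    [b < a] and half of the solutions with [x] different from [y]. If both
    [f a b] and [f (a + b) b] are invariant under the exchange, the sum of
    [f a b - f (a + b) b] over all solutions collapses to the diagonals [a = b]
    and [x = y], which are sums over the divisors of [n]. The choice
    [f a b = a ^ 2 - a b + b ^ 2] gives the sum of [a b], that is [s * s]
    ([conv_sigma]). Its analogue modulo 2, the square of the even one among [a],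
    [b] and [a - b], gives the sum of [a b] over odd [a] and [b]
    ([conv_sum_odd_divisors]), whose series is the square of [s - 2 H s]; this
    determines [H s * s] ([conv_dilate_sigma]).

    The third convolution follows from the first two by the duplication formula
    [s (2 m) = 3 s m - 2 s (m / 2)] ([conv_dilate2_sigma]): for even [n] it
    expresses [H H s * s] at [n] by convolutions at [n / 2], and for odd [n] the
    terms of [s * s] with an even first index form one half of it and combine
    [H s * s] and [H H s * s]. *)

Set Implicit Arguments.
Unset Strict Implicit.
Unset Printing Implicit Defensive.
Import GRing.Theory Num.Theory.
Local Open Scope ring_scope.

(** * Cauchy products *)

Definition dilate (f : nat -> int) (n : nat) : int :=
  if odd n then 0 else f n./2.

(** Under [f |-> sum_n f n q^n], [conv] is the product of power series and
    [dilate] is the substitution of [q ^ 2] for [q]. *)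
Definition conv (f g : nat -> int) (n : nat) : int :=
  \sum_(0 <= m < n.+1) f m * g (n - m)%N.

Lemma eq_conv f f' g g' n :
  f =1 f' -> g =1 g' -> conv f g n = conv f' g' n.
Proof. by move=> ef eg; apply: eq_bigr => m _; rewrite ef eg. Qed.

Lemma dilate_double f k : dilate f k.*2 = f k.
Proof. by rewrite /dilate odd_double doubleK. Qed.

Lemma eq_dilate f f' : f =1 f' -> dilate f =1 dilate f'.
Proof. by move=> ef n; rewrite /dilate ef. Qed.

Lemma convC f g n : conv f g n = conv g f n.
Proof.
rewrite /conv big_nat_rev /= add0n; apply: eq_big_nat => m /andP[_ lemn].
by rewrite subSS subKn // mulrC.
Qed.

Lemma conv_linear_l c f f' g n :
  conv (fun m => f m + c * f' m) g n = conv f g n + c * conv f' g n.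
Proof.
rewrite /conv mulr_sumr -big_split /=; apply: eq_bigr => m _; ring.
Qed.

Lemma conv_linear_r c f g g' n :
  conv f (fun m => g m + c * g' m) n = conv f g n + c * conv f g' n.
Proof. by rewrite convC conv_linear_l !(convC f). Qed.

Lemma conv0 f g : f 0 = 0 -> conv f g 0 = 0.
Proof. by move=> f0; rewrite /conv big_nat1 f0 mul0r. Qed.

Lemma conv_affine a b f f' g g' n :
  conv (fun m => f m + a * f' m) (fun m => g m + b * g' m) n =
  conv f g n + b * conv f g' n + a * conv f' g n + a * b * conv f' g' n.
Proof. rewrite conv_linear_l !conv_linear_r; ring. Qed.

Lemma dilate_affine c f g :
  dilate (fun m => f m + c * g m) =1 (fun m => dilate f m + c * dilate g m).
Proof. by move=> m; rewrite /dilate; case: ifP => _ //; ring. Qed.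

(** The even indices below [N] are the doubles of those below [N / 2], rounded
    up. *)
Lemma sum_dilate G N :
  \sum_(0 <= i < N) dilate G i = \sum_(0 <= m < uphalf N) G m.
Proof.
elim: N => [|N IHN]; first by rewrite !big_nil.
rewrite big_nat_recr //= IHN /dilate uphalfE /= -/(uphalf N).
rewrite uphalf_half; case: ifP => oddN; first by rewrite addr0.
by rewrite add0n big_nat_recr.
Qed.

Lemma conv_dilate_l f g n :
  conv (dilate f) g n = \sum_(0 <= m < n./2.+1) f m * g (n - m.*2)%N.
Proof.
rewrite /conv -(sum_dilate (fun m => f m * g (n - m.*2)%N) n.+1).
apply: eq_bigr => i _; rewrite /dilate; case: ifP => [|odd_i].
  by rewrite mul0r.
by rewrite even_halfK // odd_i.
Qed.

Lemma conv_dilate f g n :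
  conv (dilate f) (dilate g) n = dilate (conv f g) n.
Proof.
rewrite conv_dilate_l {2}/dilate.
case: ifP => odd_n; last first.
  apply: eq_big_nat => m _; rewrite -{1}(even_halfK (negbT odd_n)) -doubleB.
  by rewrite /dilate odd_double doubleK.
rewrite big_nat big1 // => m /andP[_ lemn].
by rewrite /dilate oddB ?odd_n ?odd_double ?mulr0 //; lia.
Qed.

Lemma conv_dilate_double f g k :
  conv (dilate f) g k.*2 = conv f (fun m => g m.*2) k.
Proof.
rewrite conv_dilate_l doubleK; apply: eq_bigr => m _.
by rewrite doubleB.
Qed.

(** If [n] is odd, exactly one of [m] and [n - m] is even, so by symmetry the
    terms with [m] even make up half of the Cauchy product of [f] with
    itself. *)
Lemma conv_odd f n : odd n ->
  conv f f n = 2 * conv (dilate (fun m => f m.*2)) f n.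
Proof.
move=> odd_n; set e := dilate _.
have fE : f =1 (fun m => e m + 1 * (f m - e m)) by move=> m; ring.
rewrite (eq_conv n fE (frefl f)) conv_linear_l mul1r.
suff -> : conv (fun m => f m - e m) f n = conv e f n by ring.
rewrite convC; apply: eq_big_nat => m /andP[_ ltmn].
rewrite /e /dilate oddB // odd_n /=.
case: (boolP (odd m)) => odd_m /=; last by rewrite even_halfK // subr0 mulrC.
by rewrite even_halfK ?subrr ?mulr0 ?mul0r // oddB // odd_n odd_m.
Qed.

(** * Divisor sums *)

(** The value 0 at 0 is imposed because [divisors 0] is [[:: 1]]; it makes
    power series without constant term. *)
Definition divisor_sum (G : nat -> int) (n : nat) : int :=
  if n is 0 then 0 else \sum_(d <- divisors n) G d.

Definition sigma (s : nat) : nat -> int := divisor_sum (fun d => d%:Z ^+ s).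

Lemma divisor_sumE G n : (0 < n)%N ->
  divisor_sum G n = \sum_(d <- divisors n) G d.
Proof. by case: n. Qed.

Lemma sum_divisors_even (G : nat -> int) n : (0 < n)%N ->
  \sum_(d <- divisors n | ~~ odd d) G d =
  dilate (divisor_sum (fun d => G d.*2)) n.
Proof.
move=> n_gt0; rewrite /dilate; case: ifP => odd_n.
  rewrite big_seq_cond big1 // => d /andP[]; rewrite -dvdn_divisors // => dn.
  by rewrite (dvdn_odd dn odd_n).
have nE : n./2.*2 = n by rewrite even_halfK ?odd_n.
have h_gt0 : (0 < n./2)%N by lia.
rewrite divisor_sumE // -big_filter -[RHS](big_map double xpredT G).
apply: perm_big.
apply: uniq_perm; first exact/filter_uniq/divisors_uniq.
  by rewrite map_inj_uniq ?divisors_uniq //; exact: double_inj.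
move=> d; rewrite mem_filter -dvdn_divisors //; apply/andP/mapP.
  case=> even_d dn; exists d./2; last by rewrite even_halfK.
  rewrite -dvdn_divisors // -(@dvdn_pmul2r 2) // !muln2 nE.
  by rewrite even_halfK.
case=> k; rewrite -dvdn_divisors // => kn ->; rewrite odd_double.
by split=> //; rewrite -nE -!muln2 dvdn_pmul2r.
Qed.

(** For [n] even, [n / d] is even exactly if [d] divides [n / 2]. *)
Lemma sum_divisors_coeven (G : nat -> int) n : (0 < n)%N ->
  \sum_(d <- divisors n | ~~ odd (n %/ d)) G d =
  dilate (divisor_sum G) n.
Proof.
move=> n_gt0; rewrite /dilate; case: ifP => odd_n.
  rewrite big_seq_cond big1 // => d /andP[]; rewrite -dvdn_divisors // => dn.
  by rewrite (dvdn_odd (dvdn_div dn) odd_n).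
have nE : n = (n./2 * 2)%N by rewrite muln2 even_halfK ?odd_n.
have h_gt0 : (0 < n./2)%N by lia.
rewrite divisor_sumE // -big_filter; apply: perm_big.
apply: uniq_perm; [exact/filter_uniq/divisors_uniq|exact: divisors_uniq|].
move=> d; rewrite mem_filter -!dvdn_divisors //; apply/andP/idP.
  case=> even_nd dn; apply/dvdnP; exists (n %/ d)./2.
  have := divnK dn; rewrite -[in X in X -> _](even_halfK even_nd).
  lia.
move=> dn; split; last by rewrite nE dvdn_mulr.
by rewrite nE -divn_mulAC // muln2 odd_double.
Qed.

Lemma sum_signed (r : seq nat) (k : nat -> nat) (G : nat -> int) :
  {in r, forall d, (0 < k d)%N} ->
  \sum_(d <- r) (-1) ^+ (k d).-1 * G d =
  \sum_(d <- r) G d - 2 * \sum_(d <- r | ~~ odd (k d)) G d.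
Proof.
move=> k_gt0; rewrite [X in _ - 2 * X]big_mkcond mulr_sumr -sumrB.
rewrite big_seq [RHS]big_seq; apply: eq_bigr => d /k_gt0.
case: (k d) => // j _ /=; rewrite -signr_odd negbK.
by case: (odd j); rewrite ?expr0 ?expr1; ring.
Qed.

Lemma sum_divisors_even_exp s n : (0 < n)%N ->
  \sum_(d <- divisors n | ~~ odd d) d%:Z ^+ s = 2 ^+ s * dilate (sigma s) n.
Proof.
move=> n_gt0; rewrite (sum_divisors_even (fun d => d%:Z ^+ s)) // /dilate.
case: ifP => odd_n; first by rewrite mulr0.
rewrite /sigma !divisor_sumE; try lia.
rewrite mulr_sumr; apply: eq_bigr => d _.
by rewrite -muln2 PoszM exprMn mulrC.
Qed.

Lemma sum_divisors_alt s n : (0 < n)%N ->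
  \sum_(d <- divisors n) (-1) ^+ d.-1 * d%:Z ^+ s =
  sigma s n + (- 2 ^+ s.+1) * dilate (sigma s) n.
Proof.
move=> n_gt0; rewrite (sum_signed (k := id)) => [|d]; last first.
  by rewrite -dvdn_divisors //; exact: dvdn_gt0.
rewrite sum_divisors_even_exp // /sigma divisor_sumE // exprS; ring.
Qed.

Lemma sum_divisors_coalt s n : (0 < n)%N ->
  \sum_(d <- divisors n) (-1) ^+ (n %/ d).-1 * d%:Z ^+ s =
  sigma s n + (- 2) * dilate (sigma s) n.
Proof.
move=> n_gt0; rewrite (sum_signed (k := fun d => n %/ d)%N) => [|d].
  by rewrite sum_divisors_coeven // /sigma divisor_sumE // mulNr.
rewrite -dvdn_divisors // => dn; rewrite divn_gt0; first exact: dvdn_leq.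
exact: dvdn_gt0 dn.
Qed.

Lemma sum_divisors_odd s n : (0 < n)%N ->
  \sum_(d <- divisors n | odd d) d%:Z ^+ s =
  sigma s n + (- 2 ^+ s) * dilate (sigma s) n.
Proof.
move=> n_gt0; rewrite {1}/sigma divisor_sumE // [in RHS](bigID odd) /=.
rewrite sum_divisors_even_exp //; ring.
Qed.

(** The even divisors of [2 n] are the doubles of the divisors of [n], and its
    odd divisors are those of [n]. *)
Lemma sigma_double s n :
  sigma s n.*2 = (1 + 2 ^+ s) * sigma s n + (- 2 ^+ s) * dilate (sigma s) n.
Proof.
case: n => [|n]; first by rewrite /dilate /=; ring.
rewrite {1}/sigma divisor_sumE // (bigID odd) /= sum_divisors_even_exp //.
rewrite {1}/dilate odd_double doubleK.
suff -> : \sum_(d <- divisors n.+1.*2 | odd d) d%:Z ^+ s =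
  \sum_(d <- divisors n.+1 | odd d) d%:Z ^+ s.
  by rewrite sum_divisors_odd //; ring.
rewrite -big_filter -[RHS]big_filter; apply: perm_big.
apply: uniq_perm; try exact/filter_uniq/divisors_uniq.
move=> d; rewrite !mem_filter -!dvdn_divisors //.
by case: (boolP (odd d)) => //= odd_d; rewrite -muln2 Gauss_dvdl ?coprimen2.
Qed.

(** * Solutions of a x + b y = n *)

(** A pair [(a, x)] stands for the factorization [m = a * x]; a quadruple
    [((a, x), (b, y))] for the solution of [a * x + b * y = n]. Enumerating the
    solutions by [m = a * x] makes sums of products [u a * v b] visibly Cauchy
    products. *)
Definition factorizations (m : nat) : seq (nat * nat) :=
  if m is 0 then [::] else [seq (d, m %/ d)%N | d <- divisors m].

Definition solutions (n : nat) : seq ((nat * nat) * (nat * nat)) :=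
  [seq pr | m <- iota 0 n.+1,
     pr <- [seq (p, r) | p <- factorizations m, r <- factorizations (n - m)]].

Lemma mem_factorizations m a x :
  ((a, x) \in factorizations m) = (0 < m)%N && (a * x == m)%N.
Proof.
case: m => [|m]; first by rewrite in_nil.
apply/mapP/eqP => [[d]|axm].
  by rewrite -dvdn_divisors // => dm [-> ->]; rewrite mulnC divnK.
have a_gt0 : (0 < a)%N by case: (a) axm.
exists a; first by rewrite -dvdn_divisors // -axm dvdn_mulr.
by rewrite -axm mulKn.
Qed.

Lemma factorizations_uniq m : uniq (factorizations m).
Proof.
by case: m => // m; rewrite map_inj_uniq ?divisors_uniq // => d e [].
Qed.

Lemma mem_solutions n a x b y :
  (((a, x), (b, y)) \in solutions n) =
  [&& 0 < a, 0 < x, 0 < b, 0 < y & a * x + b * y == n]%N.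
Proof.
apply/allpairsPdep/idP => [[m [pr [_]]]|].
  case/allpairsP => [[p r]] /= [pm rm ->] [? ?]; subst p r; move: pm rm.
  rewrite !mem_factorizations => /andP[m_gt0 /eqP axm] /andP[nm_gt0 /eqP bynm].
  rewrite axm bynm; lia.
case/and5P => a0 x0 b0 y0 /eqP <-.
exists (a * x)%N, ((a, x), (b, y)); split=> //; first by rewrite mem_iota; lia.
apply/allpairsP; exists ((a, x), (b, y)).
by rewrite !mem_factorizations addKn !eqxx !muln_gt0 a0 x0 b0 y0.
Qed.

Lemma solutions_uniq n : uniq (solutions n).
Proof.
apply: allpairs_uniq_dep; first exact: iota_uniq.
  move=> m _; apply: allpairs_uniq => [||[? ?] [? ?]] //;
    exact: factorizations_uniq.
move=> y z /allpairsPdep[m [pr [_ pr_m ->]]].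
move=> /allpairsPdep[m' [pr' [_ + ->]]] /= eq_pr; rewrite -eq_pr => pr_m'.
suff -> : m = m' by [].
have left_product k : pr \in [seq (p, r) | p <- factorizations k,
    r <- factorizations (n - k)] -> k = (pr.1.1 * pr.1.2)%N.
  case/allpairsP => [[[a x] r]] /= [+ _ ->].
  by rewrite mem_factorizations => /andP[_ /eqP].
by rewrite (left_product _ pr_m) (left_product _ pr_m').
Qed.

Lemma sum_solutions n (u v : nat -> int) :
  \sum_(q <- solutions n) u q.1.1 * v q.2.1 =
  conv (divisor_sum u) (divisor_sum v) n.
Proof.
have sum_fact w m : \sum_(p <- factorizations m) w p.1 = divisor_sum w m.
  by case: m => [|m]; rewrite ?big_nil //= big_map.
rewrite /solutions big_allpairs_dep /conv /index_iota subn0.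
apply: eq_bigr => m _; rewrite big_allpairs_dep -!sum_fact mulr_suml.
by apply: eq_bigr => d _; rewrite mulr_sumr.
Qed.

Lemma sum_reindex_bij (T T' : eqType) (r : seq T) (r' : seq T') (h : T' -> T)
    (h' : T -> T') (F : T -> int) : uniq r -> uniq r' ->
  {in r', forall y, h y \in r} -> {in r', cancel h h'} ->
  {in r, forall x, h' x \in r'} -> {in r, cancel h' h} ->
  \sum_(x <- r) F x = \sum_(y <- r') F (h y).
Proof.
move=> ur ur' hr hK h'r h'K; rewrite -[RHS](big_map h xpredT); apply: perm_big.
apply: uniq_perm => //.
  by rewrite map_inj_in_uniq //; exact: can_in_inj hK.
move=> x; apply/idP/mapP => [xr|[y yr' ->]]; last exact: hr.
by exists (h' x); [exact: h'r|rewrite h'K].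
Qed.

(** * Symmetries of the solutions *)

Definition swap (T : Type) (q : T * T) : T * T := (q.2, q.1).

Lemma swap_solutions n q : q \in solutions n -> swap q \in solutions n.
Proof. case: q => [[a x] [b y]]; rewrite !mem_solutions; lia. Qed.

(** Exchanging [(a, x)] and [(b, y)] pairs the solutions with [k] larger on the
    left with those with [k] larger on the right. It is used with [k] the first
    and with [k] the second component. *)
Lemma sum_solutions_by_order n (k : nat * nat -> nat) F :
  {in solutions n, forall q, F (swap q) = F q} ->
  \sum_(q <- solutions n) F q =
    2 * \sum_(q <- solutions n | (k q.2 < k q.1)%N) F q
    + \sum_(q <- solutions n | k q.1 == k q.2) F q :> int.
Proof.
move=> F_swap; rewrite (bigID (fun q => k q.1 == k q.2)) addrC; congr (_ + _).
rewrite (bigID (fun q => k q.2 < k q.1)%N) /= mulr_natl mulr2n; congr (_ + _).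
  by apply: eq_bigl => q; lia.
under eq_bigl => q do rewrite -leqNgt -ltn_neqAle.
rewrite -big_filter -[RHS]big_filter.
rewrite (sum_reindex_bij (r' := [seq q <- solutions n | (k q.2 < k q.1)%N])
  (h := @swap _) (h' := @swap _)) ?filter_uniq ?solutions_uniq //.
- rewrite big_seq [RHS]big_seq; apply: eq_bigr => q.
  by rewrite mem_filter => /andP[_ /F_swap].
- by move=> q; rewrite !mem_filter => /andP[-> /swap_solutions ->].
- by case.
- by move=> q; rewrite !mem_filter => /andP[-> /swap_solutions ->].
- by case.
Qed.

(** If [b < a] then [a x + b y = b (x + y) + (a - b) x], which sends the
    solutions with [b < a] bijectively to those whose first cofactor exceeds the
    second. *)
Lemma sum_solutions_shear n (F : nat -> nat -> int) :
  \sum_(q <- solutions n | (q.2.1 < q.1.1)%N) F q.1.1 q.2.1 =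
  \sum_(q <- solutions n | (q.2.2 < q.1.2)%N) F (q.1.1 + q.2.1)%N q.1.1.
Proof.
rewrite -big_filter -[RHS]big_filter.
rewrite (sum_reindex_bij (r' := [seq q <- solutions n | (q.2.2 < q.1.2)%N])
  (h := fun q => ((q.1.1 + q.2.1, q.2.2), (q.1.1, q.1.2 - q.2.2))%N)
  (h' := fun q => ((q.2.1, q.1.2 + q.2.2), (q.1.1 - q.2.1, q.1.2))%N)) //.
- exact/filter_uniq/solutions_uniq.
- exact/filter_uniq/solutions_uniq.
- case=> [[a x] [b y]]; rewrite !mem_filter !mem_solutions /=.
  case/andP=> ltyx /and5P[? ? ? ? /eqP <-].
  apply/andP; split; first lia. apply/and5P; split; nia.
- case=> [[a x] [b y]]; rewrite !mem_filter !mem_solutions /= => ?.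
  by rewrite addKn subnKC //; lia.
- case=> [[a x] [b y]]; rewrite !mem_filter !mem_solutions /=.
  case/andP=> ltba /and5P[? ? ? ? /eqP <-].
  apply/andP; split; first lia. apply/and5P; split; nia.
- case=> [[a x] [b y]]; rewrite !mem_filter !mem_solutions /= => ?.
  by rewrite addKn subnKC //; lia.
Qed.

Lemma sum_divisors_interval n (k : nat -> nat) (G : nat -> nat -> int) :
  \sum_(d <- divisors n) \sum_(1 <= i < k d) G d i =
  \sum_(p <- [seq (d, i) | d <- divisors n, i <- index_iota 1 (k d)]) G p.1 p.2.
Proof. by rewrite big_allpairs_dep. Qed.

Lemma mem_divisors_interval n (k : nat -> nat) d i : (0 < n)%N ->
  ((d, i) \in [seq (d, i) | d <- divisors n, i <- index_iota 1 (k d)]) =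
  (d %| n)%N && (0 < i < k d)%N.
Proof.
move=> n_gt0; rewrite dvdn_divisors // -mem_index_iota.
apply/allpairsPdep/andP => [[d' [i' [? ? [-> ->]]]] //|[? ?]].
by exists d, i.
Qed.

Lemma divisors_interval_uniq n (k : nat -> nat) :
  uniq [seq (d, i) | d <- divisors n, i <- index_iota 1 (k d)].
Proof.
apply: allpairs_uniq_dep; first exact: divisors_uniq.
  by move=> d _; exact: iota_uniq.
by case=> d i [d' i'] _ _ /= [-> ->].
Qed.

(** With [a = b = d], a solution splits [n / d] into two positive parts. *)
Lemma sum_solutions_eq_l n (F : nat -> nat -> int) : (0 < n)%N ->
  \sum_(q <- solutions n | q.1.1 == q.2.1) F q.1.1 q.2.1 =
  \sum_(d <- divisors n) ((n %/ d)%:Z - 1) * F d d.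
Proof.
move=> n_gt0.
transitivity (\sum_(d <- divisors n) \sum_(1 <= i < n %/ d) F d d); last first.
  rewrite big_seq [RHS]big_seq; apply: eq_bigr => d.
  rewrite -dvdn_divisors // => dn; rewrite sumr_const_nat -mulr_natl.
  have nd_gt0 : (0 < n %/ d)%N.
    by rewrite divn_gt0; [exact: dvdn_leq|exact: dvdn_gt0 dn].
  by rewrite natz subzn.
rewrite (sum_divisors_interval n (fun d => n %/ d)%N) -big_filter.
pose r' := [seq (d, i) | d <- divisors n, i <- index_iota 1 (n %/ d)].
rewrite (sum_reindex_bij (r' := r')
  (h := fun p => ((p.1, p.2), (p.1, n %/ p.1 - p.2))%N) (h' := fst)) //.
- exact/filter_uniq/solutions_uniq.
- exact: divisors_interval_uniq.
- case=> d i; rewrite mem_divisors_interval // mem_filter mem_solutions /=.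
  case/andP=> dn /andP[i_gt0 lti]; have d_gt0 := dvdn_gt0 n_gt0 dn.
  rewrite eqxx -mulnDr subnKC ?(ltnW lti) // mulnC divnK // eqxx; lia.
- by case.
- case=> [[a x] [b y]]; rewrite /r' mem_filter mem_solutions /=.
  case/andP=> /eqP <- /and5P[a_gt0 ? ? ? /eqP <-].
  by rewrite mem_divisors_interval -?mulnDr ?dvdn_mulr ?mulKn //; lia.
- case=> [[a x] [b y]]; rewrite /r' mem_filter mem_solutions /=.
  case/andP=> /eqP <- /and5P[a_gt0 ? ? ? /eqP <-].
  by rewrite -mulnDr mulKn // addKn.
Qed.

(** With [x = y], a solution splits the divisor [a + b] of [n] into two positive
    parts. *)
Lemma sum_solutions_eq_r n (F : nat -> nat -> int) : (0 < n)%N ->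
  \sum_(q <- solutions n | q.1.2 == q.2.2) F q.1.1 q.2.1 =
  \sum_(d <- divisors n) \sum_(1 <= i < d) F i (d - i)%N.
Proof.
move=> n_gt0.
rewrite (sum_divisors_interval n id (fun d i => F i (d - i)%N)) -big_filter.
pose r' := [seq (d, i) | d <- divisors n, i <- index_iota 1 d].
rewrite (sum_reindex_bij (r' := r')
  (h := fun p => ((p.2, n %/ p.1), (p.1 - p.2, n %/ p.1))%N)
  (h' := fun q => (q.1.1 + q.2.1, q.1.1)%N)) //.
- exact/filter_uniq/solutions_uniq.
- exact: (divisors_interval_uniq n id).
- case=> d i; rewrite (mem_divisors_interval id) // mem_filter mem_solutions /=.
  case/andP=> dn /andP[i_gt0 /= lti]; have d_gt0 := dvdn_gt0 n_gt0 dn.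
  rewrite eqxx -mulnDl subnKC ?(ltnW lti) // mulnC divnK // eqxx.
  by rewrite divn_gt0 // (dvdn_leq n_gt0 dn) subn_gt0 i_gt0 lti.
- case=> d i; rewrite (mem_divisors_interval id) // => /andP[_ /andP[? ?]] /=.
  by rewrite subnKC // ltnW.
- case=> [[a x] [b y]]; rewrite /r' mem_filter mem_solutions /=.
  case/andP=> /eqP <- /and5P[a_gt0 ? ? ? /eqP <-].
  by rewrite (mem_divisors_interval id) -?mulnDl ?dvdn_mulr //; lia.
- case=> [[a x] [b y]]; rewrite /r' mem_filter mem_solutions /=.
  case/andP=> /eqP <- /and5P[a_gt0 ? ? ? /eqP <-].
  by rewrite -mulnDl mulKn ?addn_gt0 ?a_gt0 // addKn.
Qed.

(** The first symmetry of [f] reduces the sum of [f a b] to twice its part with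
    [b < a] and a diagonal [a = b]; the second one reduces the sum of
    [f (a + b) b] to twice its part with [y < x] and a diagonal [x = y]. The
    shear identifies the two off-diagonal parts, so only the diagonals, which
    are sums over the divisors of [n], survive. *)
Lemma liouville_identity n (f : nat -> nat -> int) :
  (0 < n)%N -> (forall a b, f a b = f b a) ->
  (forall a b, f (a + b)%N a = f (a + b)%N b) ->
  \sum_(q <- solutions n) (f q.1.1 q.2.1 - f (q.1.1 + q.2.1)%N q.2.1) =
  \sum_(d <- divisors n)
    (((n %/ d)%:Z - 1) * f d d - \sum_(1 <= i < d) f d i).
Proof.
move=> n_gt0 f_sym f_shear; rewrite sumrB [RHS]sumrB.
rewrite (@sum_solutions_by_order n fst (fun q => f q.1.1 q.2.1)) //.
rewrite (@sum_solutions_by_order n snd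
  (fun q => f (q.1.1 + q.2.1)%N q.2.1)) => [|q _]; last first.
  by rewrite /swap /= addnC f_shear.
rewrite sum_solutions_eq_l //.
rewrite (sum_solutions_eq_r (fun a b => f (a + b)%N b)) //.
rewrite sum_solutions_shear.
under eq_bigr => q _ do rewrite f_shear.
rewrite opprD addrACA subrr add0r; congr (_ - _).
apply: eq_bigr => d _; apply: eq_big_nat => i /andP[_ lt_id].
by rewrite -f_shear subnKC // ltnW.
Qed.

(** * Convolutions of the sum of divisors *)

Lemma sum_norm_form (e : int) N :
  6 * \sum_(1 <= i < N.+1) (e ^+ 2 - e * i%:Z + i%:Z ^+ 2) =
  6 * e ^+ 2 * N%:Z - 3 * e * N%:Z * (N%:Z + 1)
  + N%:Z * (N%:Z + 1) * (2 * N%:Z + 1).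
Proof.
elim: N => [|N IHN]; first by rewrite big_nil; ring.
rewrite big_nat_recr //= mulrDr IHN !intS; ring.
Qed.

(** The quadratic form [a ^ 2 - a b + b ^ 2] has the symmetries that
    [liouville_identity] asks for, and it changes by [2 a b] under the shear, so
    that the left side there is a multiple of the convolution. *)
Lemma conv_sigma n :
  12 * conv (sigma 1) (sigma 1) n =
  5 * sigma 3 n + (1 - 6 * n%:Z) * sigma 1 n.
Proof.
case: n => [|n]; first by rewrite conv0 //= /sigma /=; ring.
pose f (a b : nat) : int := a%:Z ^+ 2 - a%:Z * b%:Z + b%:Z ^+ 2.
have := @liouville_identity n.+1 f isT.
move=> /(_ (fun a b => ltac:(rewrite /f; ring))).
move=> /(_ (fun a b => ltac:(rewrite /f PoszD; ring))).
under eq_bigr => q _.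
  rewrite (_ : _ - _ = - 2 * (q.1.1%:Z ^+ 1 * q.2.1%:Z ^+ 1)); last first.
    by rewrite /f PoszD; ring.
  over.
rewrite -mulr_sumr (sum_solutions _ (fun a => a%:Z ^+ 1) (fun b => b%:Z ^+ 1)).
move=> /(congr1 ( *%R 6)); rewrite -!/(sigma 1) [in RHS]mulr_sumr => E.
have {E} -> : 12 * conv (sigma 1) (sigma 1) n.+1 =
  - \sum_(d <- divisors n.+1)
     6 * (((n.+1 %/ d)%:Z - 1) * f d d - \sum_(1 <= i < d) f d i).
  by rewrite -E; ring.
rewrite /sigma !divisor_sumE // !mulr_sumr -sumrN -big_split /=.
rewrite big_seq [RHS]big_seq; apply: eq_bigr => d.
rewrite -dvdn_divisors // => dn.
have d_gt0 := dvdn_gt0 (ltn0Sn n) dn.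
(* Here [n / d * d ^ 2 = n * d] turns the diagonal [a = b] into the term with
   the factor [n]. *)
have := sum_norm_form d%:Z d.-1; rewrite prednK // predn_int // => E.
rewrite -[in RHS](divnK dn) PoszM mulrBr /f E; ring.
Qed.

(** Among [a], [b] and [a - b], exactly one is even unless all three are: this
    is the square of that one, and 0 in the exceptional case. Since the shear
    only permutes these parities, the function still satisfies the hypotheses of
    [liouville_identity], while the difference there singles out the pairs
    [(a, b)] with both entries odd. *)
Definition even_square (a b : nat) : int :=
  if odd a then if odd b then (a%:Z - b%:Z) ^+ 2 else b%:Z ^+ 2
  else if odd b then a%:Z ^+ 2 else 0.

Lemma even_squareC a b : even_square a b = even_square b a.
Proof. by rewrite /even_square; do 2!case: ifP => _ //; ring. Qed.

Lemma even_square_shear a b : even_square (a + b) a = even_square (a + b) b.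
Proof.
by rewrite /even_square oddD PoszD; case: (odd a); case: (odd b) => //=; ring.
Qed.

Lemma even_square_diff a b :
  even_square a b - even_square (a + b) b =
  - 4 * ((if odd a then a%:Z else 0) * (if odd b then b%:Z else 0)).
Proof.
by rewrite /even_square oddD PoszD; case: (odd a); case: (odd b) => //=; ring.
Qed.

Lemma sum_even_square_odd (e : int) k :
  3 * \sum_(1 <= i < k.*2.+1)
    (if odd i then (e - i%:Z) ^+ 2 else i%:Z ^+ 2) =
  3 * k%:Z * (e - 1) ^+ 2 - 6 * (e - 1) * k%:Z * (k%:Z - 1)
  + 2 * k%:Z * (k%:Z - 1) * (2 * k%:Z - 1)
  + 2 * k%:Z * (k%:Z + 1) * (2 * k%:Z + 1).
Proof.
elim: k => [|k IHk]; first by rewrite big_nil; ring.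
rewrite doubleS big_nat_recr //= big_nat_recr //= odd_double /= !mulrDr IHk.
rewrite !intS -muln2 PoszM; ring.
Qed.

Lemma sum_even_square_even (c : int) k :
  \sum_(1 <= i < k.*2.+1) (if odd i then c else 0) = k%:Z * c.
Proof.
elim: k => [|k IHk]; first by rewrite big_nil; ring.
rewrite doubleS big_nat_recr //= big_nat_recr //= odd_double /= IHk intS; ring.
Qed.

Lemma sum_even_square d : (0 < d)%N ->
  6 * \sum_(1 <= i < d) even_square d i =
  if odd d then 2 * d%:Z ^+ 3 - 2 * d%:Z else 3 * d%:Z ^+ 3.
Proof.
move=> d_gt0; rewrite /even_square; case: ifP => odd_d.
  have := sum_even_square_odd d%:Z d./2.
  have -> : d./2.*2.+1 = d by rewrite -[RHS]odd_double_half odd_d.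
  have -> : d%:Z = 2 * d./2%:Z + 1 by lia.
  move=> E; rewrite (_ : 6 = 2 * 3) // -mulrA E; ring.
(* The index [d] is even and contributes 0, so it may be added to the range. *)
have := sum_even_square_even (d%:Z ^+ 2) d./2.
have -> : d./2.*2.+1 = d.+1 by rewrite even_halfK ?odd_d.
rewrite big_nat_recr //= odd_d addr0 => ->.
have -> : d%:Z = 2 * d./2%:Z by lia.
ring.
Qed.

(** The function [g] sums the odd divisors, so [conv g g] is the sum of [a b]
    over the solutions with [a] and [b] odd, which [even_square] computes. *)
Lemma conv_sum_odd_divisors n :
  let g m := sigma 1 m + (- 2) * dilate (sigma 1) m in
  24 * conv g g n = 2 * sigma 3 n + 8 * dilate (sigma 3) n - 2 * sigma 1 n
    + 4 * dilate (sigma 1) n.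
Proof.
move=> g; case: n => [|n]; first by rewrite conv0 //.
pose u (d : nat) : int := if odd d then d%:Z else 0.
have gE : g =1 divisor_sum u.
  case=> [|m]; first by [].
  rewrite /g -(sum_divisors_odd 1) // divisor_sumE // big_mkcond.
  by apply: eq_bigr => d _; rewrite expr1.
rewrite (eq_conv _ gE gE) -sum_solutions.
have := liouville_identity (ltn0Sn n) even_squareC even_square_shear.
under eq_bigr => q _ do rewrite even_square_diff.
rewrite -mulr_sumr => E.
pose G d := 6 * \sum_(1 <= i < d) even_square d i.
have {E} -> : 24 * \sum_(q <- solutions n.+1) u q.1.1 * u q.2.1 =
  \sum_(d <- divisors n.+1) G d.
  transitivity (- (6 * (- 4 * \sum_(q <- solutions n.+1) u q.1.1 * u q.2.1))).
    by ring.
  rewrite E mulr_sumr -sumrN; apply: eq_bigr => d _.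
  rewrite (_ : even_square d d = 0) /G; first by ring.
  by rewrite /even_square subrr expr0n; case: (odd d).
transitivity (
  \sum_(d <- divisors n.+1 | odd d) (2 * d%:Z ^+ 3 - 2 * d%:Z ^+ 1) +
  \sum_(d <- divisors n.+1 | ~~ odd d) 3 * d%:Z ^+ 3).
  rewrite (bigID odd) /=; congr (_ + _); rewrite big_seq_cond [RHS]big_seq_cond;
  apply: eq_bigr => d /andP[]; rewrite -dvdn_divisors // => dn odd_d;
  rewrite /G sum_even_square ?(dvdn_gt0 _ dn) //.
    by rewrite odd_d expr1.
  by rewrite (negbTE odd_d).
rewrite sumrB -!mulr_sumr !sum_divisors_odd // sum_divisors_even_exp //; ring.
Qed.

Lemma dilate_conv_sigma n :
  12 * dilate (conv (sigma 1) (sigma 1)) n =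
  5 * dilate (sigma 3) n + (1 - 3 * n%:Z) * dilate (sigma 1) n.
Proof.
rewrite /dilate; case: ifP => odd_n; first by ring.
rewrite conv_sigma; have -> : n%:Z = 2 * n./2%:Z by lia.
ring.
Qed.

(** Expanding the product in [conv_sum_odd_divisors] leaves this convolution as
    the only unknown, the other terms being given by [conv_sigma]. *)
Lemma conv_dilate_sigma n :
  24 * conv (dilate (sigma 1)) (sigma 1) n =
  2 * sigma 3 n + 8 * dilate (sigma 3) n + (1 - 3 * n%:Z) * sigma 1 n
  + (1 - 6 * n%:Z) * dilate (sigma 1) n.
Proof.
have := conv_sum_odd_divisors n; rewrite /= conv_affine conv_dilate.
rewrite (convC (sigma 1) (dilate _)).
have := conv_sigma n; have := dilate_conv_sigma n.
lia.
Qed.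

Lemma dilate_conv_dilate_sigma n :
  48 * dilate (conv (dilate (sigma 1)) (sigma 1)) n =
  4 * dilate (sigma 3) n + 16 * dilate (dilate (sigma 3)) n
  + (2 - 3 * n%:Z) * dilate (sigma 1) n
  + (2 - 6 * n%:Z) * dilate (dilate (sigma 1)) n.
Proof.
rewrite /dilate; case: ifP => odd_n; first by ring.
have := conv_dilate_sigma n./2; have -> : n%:Z = 2 * n./2%:Z by lia.
rewrite /dilate; lia.
Qed.

(** The duplication formula for [sigma 1] reduces this to the previous
    convolutions: directly at [n / 2] if [n] is even, and through [conv_odd] if
    [n] is odd. *)
Lemma conv_dilate2_sigma n :
  48 * conv (dilate (dilate (sigma 1))) (sigma 1) n =
  sigma 3 n + 3 * dilate (sigma 3) n + 16 * dilate (dilate (sigma 3)) n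
  + (2 - 3 * n%:Z) * sigma 1 n + (2 - 12 * n%:Z) * dilate (dilate (sigma 1)) n.
Proof.
(* The leading 0 gives the right side the shape that [conv_linear_l] and
   [conv_linear_r] expand. *)
have sE m : sigma 1 m.*2 = 0 + 3 * sigma 1 m + (- 2) * dilate (sigma 1) m.
  by rewrite sigma_double; ring.
have [odd_n|even_n] := boolP (odd n).
  have := conv_odd (sigma 1) odd_n.
  rewrite (eq_conv _ (eq_dilate sE) (frefl _)).
  have dE m : dilate (fun m => 0 + 3 * sigma 1 m + (- 2) * dilate (sigma 1) m) m
    = 0 + 3 * dilate (sigma 1) m + (- 2) * dilate (dilate (sigma 1)) m.
    by rewrite {1 3 4}/dilate; case: ifP => _ //; ring.
  rewrite (eq_conv _ dE (frefl _)) !conv_linear_l.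
  have -> : conv (fun=> 0) (sigma 1) n = 0.
    by rewrite /conv big1 // => m _; rewrite mul0r.
  have := conv_sigma n; have := conv_dilate_sigma n; rewrite /dilate odd_n; lia.
rewrite -(even_halfK even_n); set k := n./2.
rewrite conv_dilate_double (eq_conv _ (frefl _) sE) !conv_linear_r conv_dilate.
have -> : conv (dilate (sigma 1)) (fun=> 0) k = 0.
  by rewrite /conv big1 // => m _; rewrite mulr0.
have e3 := sigma_double 3 k; rewrite e3 sE !dilate_double.
have := dilate_conv_sigma k; have := conv_dilate_sigma k; rewrite -muln2 PoszM.
lia.
Qed.

(** * Rational arguments *)

Lemma extend0_nat (f g : nat -> int) (m : nat) :
  g 0 = 0 -> (forall n, (0 < n)%N -> f n = g n) ->
  extend0 f m%:Q = g m.
Proof.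
move=> g0 fg; rewrite /extend0 intr_int numq_int ltr0z.
by case: m => [|m] /=; rewrite ?g0 // fg.
Qed.

Lemma extend0_half (f g : nat -> int) (n : nat) :
  g 0 = 0 -> (forall n, (0 < n)%N -> f n = g n) ->
  extend0 f (n%:Q / 2) = dilate g n.
Proof.
move=> g0 fg; rewrite /dilate; case: ifP => odd_n.
  rewrite /extend0 ifF //; apply/negbTE/negP => /andP[/intrP[z nz] _].
  have : n%:Q = (z * 2)%:~R by rewrite intrM -nz; field.
  by move=> /intr_inj; lia.
have -> : n%:Q / 2 = n./2%:Q; last exact: extend0_nat.
have -> : n%:Q = (n./2%:Z * 2)%:~R by congr (_%:~R); lia.
by rewrite intrM; field.
Qed.

(** For [m < n / 2] all arguments are positive integers, so the rational sum is
    a Cauchy product; the index [m = n / 2], which that product may contain,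
    contributes [g' 0 = 0]. *)
Lemma sum_extend0 (f f' g g' : nat -> int) (n : nat) : (0 < n)%N ->
  g 0 = 0 -> (forall n, (0 < n)%N -> f n = g n) ->
  g' 0 = 0 -> (forall n, (0 < n)%N -> f' n = g' n) ->
  \sum_(1 <= m < n | m%:Q < n%:Q / 2)
     extend0 f m%:Q * extend0 f' (n%:Q - 2 * m%:Q) =
  conv (dilate g) g' n.
Proof.
move=> n_gt0 g0 fg g'0 fg'.
rewrite conv_dilate_l big_ltn // g0 mul0r add0r.
rewrite (@big_nat_widen _ _ _ _ _ n); last lia.
rewrite big_mkcond [RHS]big_mkcond; apply: eq_big_nat => m /andP[m_gt0 ltmn].
have -> : (m%:Q < n%:Q / 2) = (m.*2 < n)%N.
  rewrite ltr_pdivlMr // -(intrM _ m 2) ltr_int; lia.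
case: ifP => lt2mn.
  rewrite ifT; last lia.
  have -> : n%:Q - 2 * m%:Q = (n - m.*2)%N%:Q.
    by rewrite -subzn ?(ltnW lt2mn) // intrB -muln2 PoszM intrM mulrC.
  by rewrite !(@extend0_nat _ _ _ _ fg, @extend0_nat _ _ _ _ fg').
case: ifP => // lemn; rewrite (_ : (n - m.*2)%N = 0) ?g'0 ?mulr0 //; lia.
Qed.

Lemma conv_dilate_affine a b n :
  conv (dilate (fun m => sigma 1 m + a * dilate (sigma 1) m))
       (fun m => sigma 1 m + b * dilate (sigma 1) m) n =
  conv (dilate (sigma 1)) (sigma 1) n
  + b * dilate (conv (sigma 1) (sigma 1)) n
  + a * conv (dilate (dilate (sigma 1))) (sigma 1) n
  + a * b * dilate (conv (dilate (sigma 1)) (sigma 1)) n.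
Proof.
by rewrite (eq_conv _ (dilate_affine _ _ _) (frefl _)) conv_affine !conv_dilate.
Qed.

Theorem theorem4p5 (n : nat) (hn : (0 < n)%N) :
  [/\ 8 * (\sum_(1 <= m < n | m%:Q < n%:Q / 2)
             sigma_tilde 1 m%:Q * sigma_tilde 1 (n%:Q - 2 * m%:Q))
      = - 2 * sigma_tilde 3 (n%:Q / 2) + (n%:Z - 1) * sigma_tilde 1 n%:Q
        + (2 * n%:Z - 1) * sigma_tilde 1 (n%:Q / 2),
      24 * (\sum_(1 <= m < n | m%:Q < n%:Q / 2)
             sigma_tilde 1 m%:Q * sigma_hat 1 (n%:Q - 2 * m%:Q))
      = - 2 * sigma_tilde 3 (n%:Q / 2) + (2 * n%:Z - 3) * sigma_hat 1 n%:Q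
        + 4 * n%:Z * sigma_hat 1 (n%:Q / 2) + n%:Z * sigma_tilde 1 n%:Q
        - (2 * n%:Z + 1) * sigma_tilde 1 (n%:Q / 2)
    & 24 * (\sum_(1 <= m < n | m%:Q < n%:Q / 2)
             sigma_hat 1 m%:Q * sigma_tilde 1 (n%:Q - 2 * m%:Q))
      = sigma_tilde 3 n%:Q - 3 * sigma_tilde 3 (n%:Q / 2)
        + (6 * n%:Z - 3) * sigma_hat 1 (n%:Q / 2) - sigma_tilde 1 n%:Q ].
Proof.
pose t s m := sigma s m + (- 2 ^+ s.+1) * dilate (sigma s) m.
pose h s m := sigma s m + (- 2) * dilate (sigma s) m.
have t0 s : t s 0%N = 0 by rewrite /t /dilate /sigma /=; ring.
have h0 s : h s 0%N = 0 by rewrite /h /dilate /sigma /=; ring.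
have tE := sum_divisors_alt; have hE := sum_divisors_coalt.
rewrite /sigma_tilde /sigma_hat.
rewrite !(sum_extend0 hn (t0 _) (tE _) (t0 _) (tE _)).
rewrite !(sum_extend0 hn (t0 _) (tE _) (h0 _) (hE _)).
rewrite !(sum_extend0 hn (h0 _) (hE _) (t0 _) (tE _)).
rewrite !(extend0_half _ (t0 _) (tE _)) !(extend0_half _ (h0 _) (hE _)).
rewrite !(extend0_nat _ (t0 _) (tE _)) !(extend0_nat _ (h0 _) (hE _)).
rewrite !conv_dilate_affine !dilate_affine /t /h.
have := dilate_conv_sigma n; have := dilate_conv_dilate_sigma n.
have := conv_dilate_sigma n; have := conv_dilate2_sigma n.
(* Everything is now linear in the values of [sigma 1], [sigma 3] and their
   dilates at [n], with coefficients affine in [n]. *)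
split; lia.
Qed.
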